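(* Let $G^+$ be the positive cone of a totally ordered abelian group $G$, and let $(A,G^+,\alpha,L)$ be a semigroup corner system. Put $$\mathcal{V}_g:=\begin{cases}\alpha_g & \text{if } g\ge0,\\ L_{-g}&\text{if } g\le0,\end{cases}\qquad g\in G.$$ Then $(A,G,\mathcal{V})$ is an interaction group.
   Context: $G^+$ is a subsemigroup of the abelian group $G$ with $G^+\cap(-G^+)=\{0\}$, $G=G^+\cup(-G^+)$, and $g\ge h$ means $g-h\in G^+$. $\mathrm{End}(A)$ is the semigroup of ($*$-)endomorphisms of the $C^*$-algebra $A$ and $\mathrm{Pos}(A)$ the semigroup of positive linear maps on $A$, under composition; homomorphisms of unital semigroups preserve units. A semigroup corner system $(A,G^+,\alpha,L)$ consists of semigroup homomorphisms $\alpha:G^+\to\mathrm{End}(A)$, $L:G^+\to\mathrm{Pos}(A)$ such that for every $t\in G^+$: $L_t(\alpha_t(a)b)=aL_t(b)$ for all $a,b\in A$, and $\alpha_t\circ L_t$ is a conditional expectation onto a hereditary $C^*$-subalgebra $\alpha_t(A)$ of $A$ (equivalently, given the first condition, $\alpha_t$ extends to a strictly continuous map $\overline{\alpha}_t$ on $M(A)$ and $\alpha_t(L_t(a))=\overline{\alpha}_t(1)a\overline{\alpha}_t(1)$ for all $a\in A$). For $\varrho\in\mathrm{Pos}(A)$ let $MD(\varrho)=\{a\in A:\varrho(ba)=\varrho(b)\varrho(a),\ \varrho(ab)=\varrho(a)\varrho(b)\ \forall b\in A\}$. An interaction group is a triple $(A,G,\mathcal{V})$ where $\mathcal{V}:G\to\mathrm{Pos}(A)$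 is a partial representation, i.e. $\mathcal{V}_0=\mathrm{id}$ and $\mathcal{V}_g\mathcal{V}_h\mathcal{V}_{-h}=\mathcal{V}_{g+h}\mathcal{V}_{-h}$, $\mathcal{V}_{-g}\mathcal{V}_g\mathcal{V}_h=\mathcal{V}_{-g}\mathcal{V}_{g+h}$ for all $g,h\in G$, and for every $g\in G$: $\mathcal{V}_g(A)\subseteq MD(\mathcal{V}_{-g})$ and $\mathcal{V}_{-g}(A)\subseteq MD(\mathcal{V}_g)$. (No unitality of $A$ or of the maps is assumed.) *)

(* Defs.v *)
From HB Require Import structures.
From mathcomp Require Import all_boot all_order all_algebra.
From mathcomp Require Import complex.
From mathcomp Require Import all_classical all_reals all_analysis.
Set Implicit Arguments.
Unset Strict Implicit.
Unset Printing Implicit Defensive.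
Import Order.TTheory GRing.Theory Num.Theory.
Import numFieldNormedType.Exports.
Local Open Scope classical_set_scope.
Local Open Scope ring_scope.

Declare Scope cstar_scope.
Delimit Scope cstar_scope with cstar.

(* C*-algebras need not be unital, so MathComp's ring structures (which all
   have a 1) do not apply: the product is part of the mixin.  The norm takes
   its values in the nonnegative reals of R[i]. *)
HB.mixin Record CompleteNormedModule_isCstarAlgebra (R : realType) A
    of CompleteNormedModule R[i] A := {
  cmul : A -> A -> A ;
  star : A -> A ;
  cmulA : associative cmul ;
  cmulDl : left_distributive cmul +%R ;
  cmulDr : right_distributive cmul +%R ;
  cmulZl : forall (c : R[i]) (a b : A), cmul (c *: a) b = c *: cmul a b ;
  cmulZr : forall (c : R[i]) (a b : A), cmul a (c *: b) = c *: cmul a b ;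
  starK : involutive star ;
  starD : {morph star : a b / a + b} ;
  starZ : forall (c : R[i]) (a : A), star (c *: a) = Num.conj c *: star a ;
  starM : forall a b : A, star (cmul a b) = cmul (star b) (star a) ;
  cnormM : forall a b : A, `|cmul a b| <= `|a| * `|b| ;
  cstar_identity : forall a : A, `|cmul (star a) a| = `|a| ^+ 2
}.

#[short(type="cstarAlgType")]
HB.structure Definition CstarAlgebra (R : realType) :=
  { A of CompleteNormedModule_isCstarAlgebra R A &
         CompleteNormedModule R[i] A }.

Notation "a ** b" := (cmul a b) (at level 40, left associativity) : cstar_scope.
Notation "a ^*" := (star a) : cstar_scope.
Local Open Scope cstar_scope.

Section CstarAlgebras.
Context {R : realType} {A : cstarAlgType R}.
Implicit Types (f E : {linear A -> A}) (B : set A).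

Definition positive (a : A) : Prop := exists b : A, a = b^* ** b.

Definition positive_map f : Prop := forall a : A, positive a -> positive (f a).

Definition star_endomorphism f : Prop :=
  (forall a b : A, f (a ** b) = f a ** f b) /\
  (forall a : A, f (a^*) = (f a)^*).

Record cstar_subalgebra B : Prop := CstarSubalgebra {
  subalg0 : B 0 ;
  subalgD : forall a b, B a -> B b -> B (a + b) ;
  subalgZ : forall (c : R[i]) a, B a -> B (c *: a) ;
  subalgM : forall a b, B a -> B b -> B (a ** b) ;
  subalg_star : forall a, B a -> B (a^*) ;
  subalg_closed : closed B
}.

Definition hereditary B : Prop :=
  forall a b : A, positive a -> B b -> positive b -> positive (b - a) -> B a.

Record conditional_expectation E B : Prop := ConditionalExpectation {
  condexp_range : forall a, B (E a) ;
  condexp_id : forall b, B b -> E b = b ;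
  condexp_pos : positive_map E ;
  condexp_contractive : forall a, `|E a| <= `|a| ;
  condexp_Ml : forall b a, B b -> E (b ** a) = b ** E a ;
  condexp_Mr : forall a b, B b -> E (a ** b) = E a ** b
}.

Definition multiplicative_domain f : set A :=
  [set a | forall b : A, f (b ** a) = f b ** f a /\ f (a ** b) = f a ** f b].

End CstarAlgebras.

Record positive_cone (G : zmodType) (Gp : set G) : Prop := PositiveCone {
  coneD : forall g h, Gp g -> Gp h -> Gp (g + h) ;
  cone_pointed : Gp `&` [set - g | g in Gp] = [set 0] ;
  cone_total : Gp `|` [set - g | g in Gp] = [set: G]
}.

Definition cone_ge (G : zmodType) (Gp : set G) (g h : G) : Prop := Gp (g - h).

Section SemigroupsOfMaps.
Context {R : realType} {A : cstarAlgType R} {G : zmodType}.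

(* A map defined on Gp is represented by a map on G whose values outside Gp
   are never constrained nor used. *)
Definition semigroup_hom (Gp : set G) (phi : G -> {linear A -> A}) : Prop :=
  (forall a : A, phi 0 a = a) /\
  (forall s t, Gp s -> Gp t -> forall a : A, phi (s + t) a = phi s (phi t a)).

Record semigroup_corner_system (Gp : set G)
    (alpha L : G -> {linear A -> A}) : Prop := SemigroupCornerSystem {
  corner_alpha_endo : forall t, Gp t -> star_endomorphism (alpha t) ;
  corner_alpha_hom : semigroup_hom Gp alpha ;
  corner_L_pos : forall t, Gp t -> positive_map (L t) ;
  corner_L_hom : semigroup_hom Gp L ;
  corner_transfer : forall t, Gp t ->
    forall a b : A, L t (alpha t a ** b) = a ** L t b ;
  corner_subalgebra : forall t, Gp t -> cstar_subalgebra (range (alpha t)) ;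
  corner_hereditary : forall t, Gp t -> hereditary (range (alpha t)) ;
  corner_condexp : forall t, Gp t ->
    conditional_expectation (alpha t \o L t) (range (alpha t))
}.

Record interaction_group (V : G -> {linear A -> A}) : Prop :=
    InteractionGroup {
  interaction_pos : forall g, positive_map (V g) ;
  interaction0 : forall a : A, V 0 a = a ;
  interactionr : forall g h (a : A),
    V g (V h (V (- h) a)) = V (g + h) (V (- h) a) ;
  interactionl : forall g h (a : A),
    V (- g) (V g (V h a)) = V (- g) (V (g + h) a) ;
  interaction_MD : forall g,
    range (V g) `<=` multiplicative_domain (V (- g)) ;
  interaction_MDN : forall g,
    range (V (- g)) `<=` multiplicative_domain (V g)
}.

Definition corner_interaction (Gp : set G) (alpha L : G -> {linear A -> A})
    (g : G) : {linear A -> A} :=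
  if pselect (cone_ge Gp g 0) then alpha g else L (- g).

Lemma corner_interaction_ge0 (Gp : set G) (alpha L : G -> {linear A -> A}) g :
  cone_ge Gp g 0 -> corner_interaction Gp alpha L g = alpha g.
Proof. by rewrite /corner_interaction; case: pselect. Qed.

(* The two clauses of the case distinction overlap at g = 0, where they agree. *)
Lemma corner_interaction_le0 (Gp : set G) (alpha L : G -> {linear A -> A}) g :
  positive_cone Gp -> semigroup_corner_system Gp alpha L ->
  cone_ge Gp 0 g -> corner_interaction Gp alpha L g =1 L (- g).
Proof.
move=> hGp hS; rewrite /cone_ge sub0r => gle0 a.
rewrite /corner_interaction; case: pselect => //; rewrite /cone_ge subr0 => ge0.
have : (Gp `&` [set - h | h in Gp]) g by split => //; exists (- g); rewrite ?opprK.
rewrite (cone_pointed hGp) => /= ->; rewrite oppr0.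
by rewrite (corner_alpha_hom hS).1 (corner_L_hom hS).1.
Qed.

End SemigroupsOfMaps.

(* Main.v *)
Require Import Defs.
From HB Require Import structures.
From mathcomp Require Import all_boot all_order all_algebra.
From mathcomp Require Import complex.
From mathcomp Require Import all_classical all_reals all_analysis.
Set Implicit Arguments.
Unset Strict Implicit.
Unset Printing Implicit Defensive.
Import GRing.Theory Num.Theory.
Local Open Scope classical_set_scope.
Local Open Scope ring_scope.

(* Shadows complex conjugation, which would otherwise capture [a ^*] below a
   ring operation. *)
Local Notation "a ^*" := (star a) : ring_scope.

(** Fix t in the cone and write [P = L_t \o alpha_t], [E = alpha_t \o L_t].
    In the multiplier algebra, [P] is multiplication by a central projection,
    the complement of the kernel of [alpha_t], and [E] is compression by the
    projection [alpha_t(1)].  Hence [P] for one index commutes with [E] for any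
    other index ([ideal_proj_condexp_comm]), and this commutation is the whole
    content of the partial representation identities: once the semigroup laws
    and the identities [alpha L alpha = alpha] and [L alpha L = L] have been
    used, each mixed-sign case is trivial or asks to move a [P] past an [E].

    Multipliers, approximate units and functional calculus are avoided as
    follows.  The kernel of [alpha_t] and the range of [L_t] annihilate each
    other, and an element of the kernel that the kernel annihilates is zero
    because [x^* x = 0] forces [x = 0] ([kernel_annihilator_eq0]).  This yields
    all the algebraic rules for [P], including those involving the involution,
    without knowing that the positive map [L_t] preserves it.  Heredity enters
    through the inequality [P (e^* e) <= e^* e], which puts [P (e^* e)] in the
    hereditary range of another [alpha_s] whenever [e] is in it; from there [P]
    is seen to preserve that range ([ideal_proj_range]).  The multiplicative
    domain conditions follow from the transfer identity and its mirror image
    [corner_transferr]. *)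

(** * Products and the involution *)

Section CstarArithmetic.
Context {R : realType} {A : cstarAlgType R}.
Implicit Types a b c : A.
Local Open Scope cstar_scope.

Lemma cmul0l a : 0 ** a = 0.
Proof. by apply: (addrI (0 ** a)); rewrite -cmulDl !addr0. Qed.

Lemma cmul0r a : a ** 0 = 0.
Proof. by apply: (addrI (a ** 0)); rewrite -cmulDr !addr0. Qed.

Lemma cmulNl a b : (- a) ** b = - (a ** b).
Proof. by apply: (addrI (a ** b)); rewrite -cmulDl !subrr cmul0l. Qed.

Lemma cmulNr a b : a ** (- b) = - (a ** b).
Proof. by apply: (addrI (a ** b)); rewrite -cmulDr !subrr cmul0r. Qed.

Lemma cmulBl a b c : (a - b) ** c = a ** c - b ** c.
Proof. by rewrite cmulDl cmulNl. Qed.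

Lemma cmulBr a b c : a ** (b - c) = a ** b - a ** c.
Proof. by rewrite cmulDr cmulNr. Qed.

Lemma star0 : (0 : A)^* = 0.
Proof. by apply: (addrI ((0 : A)^*)); rewrite -starD !addr0. Qed.

Lemma starN a : (- a)^* = - a^*.
Proof. by apply: (addrI (a^*)); rewrite -starD !subrr star0. Qed.

Lemma starB a b : (a - b)^* = a^* - b^*.
Proof. by rewrite starD starN. Qed.

Lemma star_mul_eq0 a : a^* ** a = 0 -> a = 0.
Proof.
move=> aa0; apply/eqP; rewrite -normr_eq0.
by have := cstar_identity a; rewrite aa0 normr0 => /esym/eqP; rewrite sqrf_eq0.
Qed.

Lemma polarization a b :
  2%:R *: (a^* ** b) =
    ((a + b)^* ** (a + b) - a^* ** a - b^* ** b) -
    ('i : R[i]) *: ((a + 'i *: b)^* ** (a + 'i *: b) - a^* ** a - b^* ** b).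
Proof.
rewrite !starD !starZ !cmulDl !cmulDr !cmulZl !cmulZr conjCi.
set u := a^* ** a; set v := a^* ** b; set w := b^* ** a; set z := b^* ** b.
rewrite !scalerA.
have ii : 'i * 'i = -1 :> R[i] by rewrite -expr2 sqrCi.
have -> : - 'i * 'i = 1 :> R[i] by rewrite mulNr ii opprK.
rewrite scale1r.
have -> : u + v + (w + z) - u - z = v + w.
  by rewrite (addrC w) addrACA -[LHS]addrA -opprD addrC addKr.
have -> : u + 'i *: v + (- 'i *: w + z) - u - z = 'i *: v - 'i *: w.
  by rewrite (addrC (- 'i *: w)) addrACA -[LHS]addrA -opprD addrC addKr scaleNr.
rewrite scalerBr !scalerA ii !scaleN1r opprB opprK.
by rewrite addrA addrK scaler_nat mulr2n.
Qed.

End CstarArithmetic.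

(** * One endomorphism with its transfer operator *)

(** The part of a semigroup corner system that concerns a single index. *)
Record corner_pair (R : realType) (A : cstarAlgType R)
    (alpha L : {linear A -> A}) : Prop := CornerPair {
  pair_endo : star_endomorphism alpha ;
  pair_transfer : forall a b, L (cmul (alpha a) b) = cmul a (L b) ;
  pair_subalgebra : cstar_subalgebra (range alpha) ;
  pair_hereditary : hereditary (range alpha) ;
  pair_condexp : conditional_expectation (alpha \o L) (range alpha)
}.

Section CornerPair.
Context {R : realType} {A : cstarAlgType R} {alpha L : {linear A -> A}}.
Hypothesis hc : corner_pair alpha L.
Implicit Types a b c x : A.
Local Open Scope cstar_scope.

Lemma corner_alphaM a b : alpha (a ** b) = alpha a ** alpha b.
Proof. exact: (pair_endo hc).1. Qed.

Lemma corner_alpha_star a : alpha (a^*) = (alpha a)^*.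
Proof. exact: (pair_endo hc).2. Qed.

Lemma corner_alphaK a : alpha (L (alpha a)) = alpha a.
Proof. by apply: (condexp_id (pair_condexp hc)); exists a. Qed.

(** Applied to a difference [x = u - v], this proves [u = v] from an equality
    of images under [alpha]; it stands in for injectivity of [alpha] on the
    range of [L]. *)
Lemma kernel_annihilator_eq0 x :
  alpha x = 0 -> (forall c, alpha c = 0 -> c ** x = 0) -> x = 0.
Proof.
move=> ax0; move=> /(_ (x^*)) xx0; apply/star_mul_eq0/xx0.
by rewrite corner_alpha_star ax0 star0.
Qed.

Lemma kernel_mulL c b : alpha c = 0 -> c ** L b = 0.
Proof. by move=> ac0; rewrite -(pair_transfer hc) ac0 cmul0l linear0. Qed.

(** The mirror image of the transfer identity is visible after applying
    [alpha], where it is the bimodule property of the expectation. *)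
Lemma corner_transferr a b : L (b ** alpha a) = L b ** a.
Proof.
apply/eqP; rewrite -subr_eq0; apply/eqP/kernel_annihilator_eq0 => [|c ac0].
  rewrite linearB /= corner_alphaM.
  have /= -> := condexp_Mr (pair_condexp hc) b (ex_intro2 _ _ a I erefl).
  by rewrite subrr.
by rewrite cmulBr kernel_mulL // cmulA kernel_mulL // cmul0l subrr.
Qed.

Lemma corner_LK b : L (alpha (L b)) = L b.
Proof.
apply/eqP; rewrite -subr_eq0; apply/eqP/kernel_annihilator_eq0 => [|c ac0].
  by rewrite linearB /= corner_alphaK subrr.
by rewrite cmulBr !kernel_mulL // subrr.
Qed.

Lemma mulL_kernel c b : alpha c = 0 -> L b ** c = 0.
Proof. by move=> ac0; rewrite -corner_transferr ac0 cmul0r linear0. Qed.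

Lemma ideal_projMr a b : L (alpha (a ** b)) = a ** L (alpha b).
Proof. by rewrite corner_alphaM (pair_transfer hc). Qed.

Lemma ideal_projMl a b : L (alpha (a ** b)) = L (alpha a) ** b.
Proof. by rewrite corner_alphaM corner_transferr. Qed.

Lemma ideal_proj_star a : L (alpha (a^*)) = (L (alpha a))^*.
Proof.
apply/eqP; rewrite -subr_eq0; apply/eqP/kernel_annihilator_eq0 => [|c ac0].
  by rewrite linearB /= corner_alphaK !corner_alpha_star corner_alphaK subrr.
rewrite cmulBr kernel_mulL // -[c in c ** _^*]starK -starM mulL_kernel.
  by rewrite star0 subrr.
by rewrite corner_alpha_star ac0 star0.
Qed.

Lemma ideal_proj_square e :
  L (alpha (e^* ** e)) = (L (alpha e))^* ** L (alpha e).
Proof. by rewrite -ideal_proj_star -ideal_projMl !ideal_projMr corner_LK. Qed.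

(** The difference is the square of [e - L (alpha e)], as it should be for a
    central projection. *)
Lemma ideal_proj_square_le e :
  positive (e^* ** e - L (alpha (e^* ** e))).
Proof.
exists (e - L (alpha e)).
rewrite starB cmulBl !cmulBr -ideal_proj_square.
by rewrite -ideal_projMr -ideal_proj_star -ideal_projMl subrr subr0.
Qed.

(** [a - L (alpha a)] lies in the kernel of [alpha], so it is annihilated by the
    range of [L], and the two transfer identities give multiplicativity. *)
Lemma corner_range_MD_L : range alpha `<=` multiplicative_domain L.
Proof.
move=> _ [a _ <-] b; split.
- rewrite corner_transferr -[a in LHS](subrK (L (alpha a))) cmulDr.
  by rewrite mulL_kernel ?add0r // linearB /= corner_alphaK subrr.
- rewrite (pair_transfer hc) -[a in LHS](subrK (L (alpha a))) cmulDl.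
  by rewrite kernel_mulL ?add0r // linearB /= corner_alphaK subrr.
Qed.

End CornerPair.

(** * Ideal projections commute with corner expectations *)

Section TwoCorners.
Context {R : realType} {A : cstarAlgType R}.
Context {alpha L beta K : {linear A -> A}}.
Hypotheses (ha : corner_pair alpha L) (hb : corner_pair beta K).
Implicit Types a b d x : A.
Local Open Scope cstar_scope.

Let B : set A := range beta.
Let P a := L (alpha a).
Let E a := beta (K a).

Let PB a b : P (a - b) = P a - P b.
Proof. by rewrite /P !linearB. Qed.

Let EB a b : E (a - b) = E a - E b.
Proof. by rewrite /E !linearB. Qed.

Let E_range a : B (E a).
Proof. by exists (K a). Qed.

Let E_id b : B b -> E b = b.
Proof. exact: (condexp_id (pair_condexp hb)). Qed.

Let E_Ml b a : B b -> E (b ** a) = b ** E a.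
Proof. exact: (condexp_Ml (pair_condexp hb)). Qed.

Let B_sub a b : B a -> B b -> B (a - b).
Proof. by move=> [a' _ <-] [b' _ <-]; exists (a' - b'); rewrite // linearB. Qed.

Lemma ideal_proj_square_range e : B e -> B (P (e^* ** e)).
Proof.
move=> Be; apply: (pair_hereditary hb) (ideal_proj_square_le ha e).
- by exists (L (alpha e)); rewrite /P (ideal_proj_square ha).
- by apply: subalgM; [exact: pair_subalgebra hb|
    apply: subalg_star => //; exact: pair_subalgebra hb|].
- by exists e.
Qed.

(** Heredity controls squares only; polarization extends this to products. *)
Lemma ideal_proj_mul_range b d : B b -> B d -> B (P (b ** d)).
Proof.
have sB := pair_subalgebra hb.
move=> Bb Bd; have Bs := subalg_star sB Bb.
have PZ (k : R[i]) a : P (k *: a) = k *: P a by rewrite /P !linearZ.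
have -> : b ** d = 2%:R^-1 *: (2%:R *: (b^*^* ** d)).
  by rewrite starK scalerA mulVf ?scale1r // pnatr_eq0.
rewrite polarization PZ PB PZ !PB.
have Bi : B (b^* + 'i *: d) by apply: subalgD => //; exact: subalgZ.
apply: subalgZ => //; apply: B_sub; last apply: subalgZ => //;
  do !apply: B_sub; apply: ideal_proj_square_range => //.
exact: subalgD.
Qed.

(** Let [r = P d - E (P d)].  Every [b] in [B] satisfies [b ** r = 0] because
    [b ** P d = P (b ** d)] is fixed by [E].  In particular [(E (P d))^*]
    annihilates [r], and so does [(P d)^*], as [(P d)^* ** r = P (d^* ** r)].
    Hence [r^* ** r = 0]. *)
Lemma ideal_proj_range d : B d -> B (P d).
Proof.
have sB := pair_subalgebra hb.
move=> Bd; set r := P d - E (P d).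
have Br b : B b -> b ** r = 0.
  move=> Bb; rewrite cmulBr -E_Ml // /P -(ideal_projMr ha).
  by rewrite E_id ?subrr //; exact: ideal_proj_mul_range.
suff r0 : r = 0 by rewrite -(subrK (E (P d)) (P d)) -/r r0 add0r.
apply: star_mul_eq0; rewrite {1}/r starB cmulBl.
rewrite [X in _ - X]Br; last exact: subalg_star.
rewrite /P -(ideal_proj_star ha) -(ideal_projMl ha) Br; last exact: subalg_star.
  by rewrite subr0 !linear0.
Qed.

(** Let [k = E (P a) - P (E (P a))], an element of [B] in the kernel of [alpha].
    Then [k^*] annihilates the range of [P], hence also [E (P a)], because
    [k^* ** E (P a) = E (k^* ** P a)].  So [k^* ** k = 0]. *)
Lemma ideal_proj_condexp_proj a : P (E (P a)) = E (P a).
Proof.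
have sB := pair_subalgebra hb.
set y := E (P a); pose k := y - P y.
have By : B y by exact: E_range.
have Bk : B k by apply: B_sub => //; exact: ideal_proj_range.
have ak0 : alpha (k^*) = 0.
  by rewrite (corner_alpha_star ha) linearB /= (corner_alphaK ha) subrr star0.
apply/esym/eqP; rewrite -subr_eq0 -/k; apply/eqP/star_mul_eq0.
rewrite {2}/k cmulBr /P (kernel_mulL ha) // subr0 /y -E_Ml.
  by rewrite /P (kernel_mulL ha) // /E !linear0.
exact: subalg_star.
Qed.

(** [n = P (E k)] lies in [B], so that
    [n^* ** n = P (n^* ** E k) = P (E (n^* ** k))], and [n^* ** k = 0] because
    [n^*] is in the range of [P] and [k] in the kernel of [alpha]. *)
Lemma condexp_kernel k : alpha k = 0 -> P (E k) = 0.
Proof.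
have sB := pair_subalgebra hb.
move=> ak0; set n := P (E k); apply: star_mul_eq0.
have Bn : B (n^*) by apply: subalg_star => //; exact: ideal_proj_range.
rewrite {2}/n /P -(ideal_projMr ha) -E_Ml // /n /P -(ideal_proj_star ha).
by rewrite (mulL_kernel ha) // /E !linear0.
Qed.

(** Split [a] as [P a], whose image under [E] is fixed by [P], plus an element
    of the kernel of [alpha], whose image under [E] is killed by [P]. *)
Lemma ideal_proj_condexp_comm a :
  L (alpha (beta (K a))) = beta (K (L (alpha a))).
Proof.
have k0 : alpha (a - P a) = 0 by rewrite linearB /= (corner_alphaK ha) subrr.
have := condexp_kernel k0; rewrite EB PB => /eqP; rewrite subr_eq0 => /eqP.
by rewrite ideal_proj_condexp_proj.
Qed.

End TwoCorners.

(** * The interaction group *)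

Section ConeOrder.
Context {G : zmodType} {Gp : set G}.
Hypothesis hGp : positive_cone Gp.
Implicit Types g h s t : G.

Lemma cone0 : Gp 0.
Proof.
have : (Gp `&` [set - g | g in Gp]) 0 by rewrite (cone_pointed hGp).
by case.
Qed.

Lemma cone_cases g : Gp g \/ exists2 t, Gp t & g = - t.
Proof.
have : (Gp `|` [set - h | h in Gp]) g by rewrite (cone_total hGp).
by case=> [|[t Gt <-]]; [left|right; exists t].
Qed.

Lemma cone_diff s t :
  (exists2 u, Gp u & t = s + u) \/ (exists2 u, Gp u & s = t + u).
Proof.
have [Gd|[u Gu e]] := cone_cases (t - s).
- by left; exists (t - s) => //; rewrite addrC subrK.
- by right; exists u => //; rewrite -(opprK u) -e opprB addrC subrK.
Qed.

End ConeOrder.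

Lemma corner_system_pair (R : realType) (A : cstarAlgType R) (G : zmodType)
    (Gp : set G) (alpha L : G -> {linear A -> A}) t :
  semigroup_corner_system Gp alpha L -> Gp t -> corner_pair (alpha t) (L t).
Proof.
move=> hS Gt; split; [exact: corner_alpha_endo hS _ Gt|
  exact: corner_transfer hS _ Gt|exact: corner_subalgebra hS _ Gt|
  exact: corner_hereditary hS _ Gt|exact: corner_condexp hS _ Gt].
Qed.

Lemma star_endomorphism_positive (R : realType) (A : cstarAlgType R)
    (f : {linear A -> A}) : star_endomorphism f -> positive_map f.
Proof. by move=> [fM fs] _ [b ->]; exists (f b); rewrite fM fs. Qed.

Section Interaction.
Context {R : realType} {A : cstarAlgType R} {G : zmodType} {Gp : set G}.
Context {alpha L : G -> {linear A -> A}}.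
Hypotheses (hGp : positive_cone Gp) (hS : semigroup_corner_system Gp alpha L).
Implicit Types (g h s t u : G) (a : A).

Let V := corner_interaction Gp alpha L.

Let V_ge0 t a : Gp t -> V t a = alpha t a.
Proof. by move=> Gt; rewrite /V corner_interaction_ge0 // /cone_ge subr0. Qed.

Let V_le0 t a : Gp t -> V (- t) a = L t a.
Proof.
move=> Gt; rewrite /V (corner_interaction_le0 hGp hS) ?opprK //.
by rewrite /cone_ge sub0r opprK.
Qed.

Let alphaD s t a : Gp s -> Gp t -> alpha (s + t) a = alpha s (alpha t a).
Proof. by move=> *; apply: (corner_alpha_hom hS).2. Qed.

Let LD s t a : Gp s -> Gp t -> L (s + t) a = L s (L t a).
Proof. by move=> *; apply: (corner_L_hom hS).2. Qed.

Let GD s t : Gp s -> Gp t -> Gp (s + t).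
Proof. exact: coneD hGp s t. Qed.

Let pr t (Gt : Gp t) := corner_system_pair hS Gt.

Lemma corner_interactionr g h a :
  V g (V h (V (- h) a)) = V (g + h) (V (- h) a).
Proof.
have [Gg|[s Gs ->]] := cone_cases hGp g;
  have [Gh|[t Gt ->]] := cone_cases hGp h; rewrite ?opprK.
- by rewrite [V (- h) a]V_le0 // !V_ge0 ?alphaD //; exact: GD.
- rewrite [V t a]V_ge0 // [V (- t) _]V_le0 // [V g _]V_ge0 //.
  have [[u Gu e]|[u Gu e]] := cone_diff hGp g t.
  + have -> : g - t = - u by rewrite e opprD addrA subrr add0r.
    rewrite V_le0 // e [L _ _]LD // addrC alphaD //.
    rewrite -(ideal_proj_condexp_comm (pr Gu) (pr Gg)).
    by rewrite (corner_alphaK (pr Gg)).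
  + have -> : g - t = u by rewrite e addrC addKr.
    by rewrite V_ge0 // e addrC alphaD // (corner_alphaK (pr Gt)).
- rewrite [V (- h) a]V_le0 // [V h _]V_ge0 // [V (- s) _]V_le0 //.
  have [[u Gu e]|[u Gu e]] := cone_diff hGp s h.
  + have -> : - s + h = u by rewrite e addKr.
    rewrite V_ge0 // e [alpha (s + u) _]alphaD // addrC LD //.
    by rewrite (ideal_proj_condexp_comm (pr Gs) (pr Gu)) (corner_LK (pr Gs)).
  + have -> : - s + h = - u by rewrite e opprD addrAC addNr add0r.
    by rewrite V_le0 // e addrC LD // (corner_LK (pr Gh)).
- by rewrite -opprD [V t a]V_ge0 // !V_le0 ?LD //; exact: GD.
Qed.

Lemma corner_interactionl g h a :
  V (- g) (V g (V h a)) = V (- g) (V (g + h) a).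
Proof.
have [Gg|[s Gs ->]] := cone_cases hGp g;
  have [Gh|[t Gt ->]] := cone_cases hGp h; rewrite ?opprK.
- by rewrite !V_le0 // !V_ge0 ?alphaD //; exact: GD.
- rewrite !V_le0 // V_ge0 //.
  have [[u Gu e]|[u Gu e]] := cone_diff hGp g t.
  + have -> : g - t = - u by rewrite e opprD addrA subrr add0r.
    by rewrite V_le0 // e LD // (corner_LK (pr Gg)).
  + have -> : g - t = u by rewrite e addrC addKr.
    rewrite V_ge0 // e !LD // addrC alphaD //.
    by rewrite (ideal_proj_condexp_comm (pr Gu) (pr Gt)) (corner_LK (pr Gt)).
- rewrite [V h a]V_ge0 // [V (- s) _]V_le0 // ![V s _]V_ge0 //.
  have [[u Gu e]|[u Gu e]] := cone_diff hGp s h.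
  + have -> : - s + h = u by rewrite e addKr.
    by rewrite V_ge0 // e !alphaD // (corner_alphaK (pr Gs)).
  + have -> : - s + h = - u by rewrite e opprD addrAC addNr add0r.
    rewrite V_le0 // e !alphaD // addrC LD //.
    rewrite -(ideal_proj_condexp_comm (pr Gh) (pr Gu)).
    by rewrite (corner_alphaK (pr Gh)).
- by rewrite -opprD ![V s _]V_ge0 // !V_le0 ?LD //; exact: GD.
Qed.

Lemma corner_interaction_MD g :
  range (V g) `<=` multiplicative_domain (V (- g)).
Proof.
have [Gg|[t Gt ->]] := cone_cases hGp g; move=> _ [a _ <-] b.
- rewrite ![V g _]V_ge0 // !V_le0 //.
  by apply: (corner_range_MD_L (pr Gg)); exists a.
- by rewrite opprK !V_le0 // !V_ge0 // !(corner_alphaM (pr Gt)).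
Qed.

Lemma corner_interaction_pos g : positive_map (V g).
Proof.
have [Gg|[t Gt ->]] := cone_cases hGp g => a pa.
- rewrite V_ge0 //; apply: star_endomorphism_positive pa.
  exact: corner_alpha_endo hS _ Gg.
- by rewrite V_le0 //; apply: corner_L_pos hS _ Gt _ pa.
Qed.

End Interaction.

Theorem proposition8p5 (R : realType) (A : cstarAlgType R) (G : zmodType)
    (Gp : set G) (hGp : positive_cone Gp)
    (alpha L : G -> {linear A -> A})
    (hS : semigroup_corner_system Gp alpha L) :
  interaction_group (corner_interaction Gp alpha L).
Proof.
split.
- exact: corner_interaction_pos hGp hS.
- move=> a; rewrite corner_interaction_ge0.
    exact: (corner_alpha_hom hS).1.
  by rewrite /cone_ge subrr; exact: cone0 hGp.
- exact: corner_interactionr hGp hS.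
- exact: corner_interactionl hGp hS.
- exact: corner_interaction_MD hGp hS.
- move=> g; rewrite -[X in multiplicative_domain (_ X)]opprK.
  exact: corner_interaction_MD hGp hS _.
Qed.
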